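(* There exists $n_0\in \mathbb{N}$ such that for all $n>n_0$ and every colouring of the edges of the complete graph $K_n$ with two colours (red and blue), there exists a collection of at most $\sqrt{n}$ monochromatic paths, all of the same colour, whose union covers every vertex of $K_n$.
   Context: A path may have length zero (i.e. consist of a single vertex). The paths in the collection need not be vertex-disjoint. A path is monochromatic of a given colour if all of its edges have that colour. *)

(* Defs.v *)
From mathcomp Require Import all_boot.
Set Implicit Arguments. Unset Strict Implicit. Unset Printing Implicit Defensive.

(* A 2-edge-colouring of K_n on vertex set 'I_n: c u v is the colour of the
   edge uv (true = red, false = blue); it must be symmetric.  Values c u u
   are irrelevant (no loops). *)
Definition edge_colouring (n : nat) (c : 'I_n -> 'I_n -> bool) : Prop :=
  forall u v : 'I_n, u != v -> c u v = c v u.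

Definition mono_colour_path (n : nat) (c : 'I_n -> 'I_n -> bool) (b : bool)
    (p : seq 'I_n) : Prop :=
  match p with
  | [::] => False
  | x :: s => uniq (x :: s) /\ path (fun u v => c u v == b) x s
  end.

Definition covers (n : nat) (P : seq (seq 'I_n)) : Prop :=
  forall v : 'I_n, exists2 p, p \in P & v \in p.

(* Main.v *)
Require Import Defs.
From mathcomp Require Import all_boot zify ring.
Set Implicit Arguments. Unset Strict Implicit. Unset Printing Implicit Defensive.

(**
  Let k be the integer part of sqrt n.  By Gerencser and Gyarfas the vertices
  split into a red and a blue path.  A bipartite lemma drives the argument: if
  #|U| and #|W| are at most 0.99 r s, then r red paths cover U or s blue paths
  cover W; it follows from depth-first search, which either finds a long red
  path or a balanced pair of sets with all edges blue in between.  It settles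
  the case where neither path has almost all the vertices.

  Otherwise take a longest path Q, say blue, containing the dominating one, and
  let X' be its complement, which one red path covers.  If a vertex of X' has
  many blue neighbours on Q, their successors form a red clique (rotation), and
  the bipartite lemma covers what remains of Q.  Otherwise any two vertices of
  X' have many common red neighbours, so red paths can be threaded through X':
  - if #|X'| >= 1.1 k, such paths cover all but 0.06 n vertices of Q with k / 11
    paths to spare, and the bipartite lemma finishes;
  - if #|X'| < k, blue paths suffice: Q and single vertices;
  - if #|X'| = k + j with j < k / 10, a blue matching of size 2 j + 2 between X'
    and Q lets j + 1 blue paths cover 2 j + 2 vertices of X' in pairs, which is
    enough of a saving.  Without such a matching, up to O(j) vertices all edges
    between X' and Q are red, and k red paths, each running through the whole of
    X', cover k (#|X'| + 1) >= #|Q| vertices of Q.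
*)

(** * Preliminaries on finite sets *)

Ltac count_perm := apply/permP => ?; rewrite /= !count_cat /=; ring.

Lemma disjointI (T : finType) (pA pB : predType T) (A : pA) (B : pB) :
  (forall x, x \in A -> x \notin B) -> [disjoint A & B].
Proof. by move=> AB; apply/pred0P => x /=; apply/andP => -[/AB/negP]. Qed.

Lemma ex_outside (T : finType) (A N : {set T}) : #|N| < #|A| -> exists2 x, x \in A & x \notin N.
Proof.
move=> ltNA; have /set0Pn[x /setDP[xA xN]] : A :\: N != set0; last by exists x.
rewrite -card_gt0 cardsD subn_gt0; apply: leq_ltn_trans ltNA.
exact: subset_leq_card (subsetIr _ _).
Qed.

Lemma subset_between (T : finType) (A B : {set T}) m :
  A \subset B -> #|A| <= m <= #|B| ->
  exists C : {set T}, [/\ A \subset C, C \subset B & #|C| = m].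
Proof.
move=> sAB /andP[]; elim: m => [|m IHm] Am mB.
  by exists A; split=> //; apply/eqP; rewrite -leqn0.
case: (ltnP m #|A|) => [mA|Am'].
  by exists A; split=> //; apply/eqP; rewrite eqn_leq Am.
have [C [sAC sCB cardC]] := IHm Am' (ltnW mB).
have [|x xB xC] := @ex_outside _ B C; first by rewrite cardC.
exists (x |: C); split; last by rewrite cardsU1 xC cardC.
  exact: subset_trans sAC (subsetUr _ _).
by rewrite subUset sub1set xB.
Qed.

(** * Interleaving two sequences into an alternating path *)

Section Alternation.
Variable T : eqType.

Fixpoint weave (xs ys : seq T) : seq T :=
  if xs is x :: xs' then
    if ys is y :: ys' then [:: x, y & weave xs' ys'] else [::]
  else [::].

Lemma perm_weave xs ys : size xs = size ys -> perm_eq (weave xs ys) (xs ++ ys).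
Proof.
elim: xs ys => [|x xs IHxs] [|y ys] //= [/IHxs eq_s].
rewrite perm_cons perm_sym -cat1s perm_catCA perm_cons perm_sym.
exact: eq_s.
Qed.

Lemma weave_uniq xs ys : size xs = size ys -> uniq (weave xs ys) = uniq (xs ++ ys).
Proof. by move/perm_weave/perm_uniq. Qed.

Lemma mem_weave xs ys x :
  size xs = size ys -> (x \in weave xs ys) = (x \in xs) || (x \in ys).
Proof. by move/perm_weave/perm_mem->; rewrite mem_cat. Qed.

Lemma last_weave x xs ys : size xs = size ys ->
  last x (weave xs ys) = last x ys.
Proof. by elim: xs ys x => [|x xs IHxs] [|y ys] z //= [/IHxs ->]. Qed.

Lemma weave_cat xs xs' ys ys' : size xs = size ys ->
  weave (xs ++ xs') (ys ++ ys') = weave xs ys ++ weave xs' ys'.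
Proof. by elim: xs ys => [|x xs IHxs] [|y ys] //= [/IHxs->]. Qed.

Lemma uniq_catP (s t : seq T) : reflect
  [/\ uniq s, uniq t & forall x, x \in t -> x \notin s] (uniq (s ++ t)).
Proof.
rewrite cat_uniq; apply: (iffP and3P) => [[us /hasPn H ut]|[us ut H]]; split=> //.
exact/hasPn.
Qed.

Variable e : rel T.

Lemma sorted_cat p x q : sorted e (p ++ x :: q) =
  [&& sorted e p, sorted e (x :: q) & if p is y :: p' then e (last y p') x else true].
Proof. by case: p => [|y p] /=; rewrite ?andbT // cat_path /= andbCA andbC -andbA andbC -andbA. Qed.

Lemma path_weave z xs ys : symmetric e -> size xs = size ys ->
  {in xs & z :: ys, forall x y, e x y} -> path e z (weave xs ys).
Proof.
move=> sym; elim: xs ys z => [|x xs IHxs] [|y ys] z //= [sz] exy.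
rewrite sym !exy ?inE ?eqxx ?orbT //= IHxs // => u v ux vy.
by rewrite exy // inE ?ux ?vy orbT.
Qed.

End Alternation.

(** * Monochromatic paths and covers in a two-coloured complete graph *)

Section TwoColouring.
Variables (V : finType) (c : V -> V -> bool).
Hypothesis c_sym : symmetric c.

Definition hue (b : bool) : rel V := fun u v => c u v == b.

Definition mpath b p := uniq p && sorted (hue b) p.

(** The paths may overlap, be empty and leave [A], so that covers restrict to subsets and add up
    under unions. *)
Definition cov b k (A : {set V}) := exists P : seq (seq V),
  [/\ size P <= k, {in P, forall p, mpath b p}
    & {in A, forall v, exists2 p, p \in P & v \in p}].

Lemma hue_sym b : symmetric (hue b).
Proof. by move=> u v; rewrite /hue c_sym. Qed.

Lemma hueN b u v : ~~ hue b u v = hue (~~ b) u v.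
Proof. by rewrite /hue; case: (c u v) b => [] []. Qed.

Lemma cov_sub b k l (A B : {set V}) :
  k <= l -> B \subset A -> cov b k A -> cov b l B.
Proof.
move=> kl /subsetP sBA [P [szP mP covP]]; exists P; split=> //.
  exact: leq_trans kl.
by move=> v /sBA/covP.
Qed.

Lemma covU b k l (A B : {set V}) :
  cov b k A -> cov b l B -> cov b (k + l) (A :|: B).
Proof.
move=> [P [szP mP covP]] [Q [szQ mQ covQ]]; exists (P ++ Q); split.
- by rewrite size_cat leq_add.
- by move=> p; rewrite mem_cat => /orP[/mP|/mQ].
- move=> v /setUP[/covP|/covQ] [p pin vp]; exists p => //; rewrite mem_cat pin //.
  by rewrite orbT.
Qed.

Lemma cov_path b p : mpath b p -> cov b 1 [set x in p].
Proof.
move=> mp; exists [:: p]; split=> // [q|v].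
  by rewrite inE => /eqP->.
by rewrite inE => vp; exists p; rewrite ?inE.
Qed.

Lemma cov_singles b (A : {set V}) : cov b #|A| A.
Proof.
exists [seq [:: x] | x <- enum A]; split.
- by rewrite size_map -cardE.
- by move=> p /mapP[x _ ->].
- by move=> v vA; exists [:: v]; rewrite ?inE // map_f // mem_enum.
Qed.

Lemma cov_clique b (A : {set V}) :
  {in A &, forall u v, u != v -> hue b u v} -> cov b 1 A.
Proof.
move=> cA; apply: (cov_sub (leqnn 1) _ (cov_path (p := enum A) _)).
  by apply/subsetP => x; rewrite inE mem_enum.
rewrite /mpath enum_uniq /=.
have sA : {subset enum A <= A} by move=> x; rewrite mem_enum.
elim: (enum A) (enum_uniq A) sA => // x [|y s] // IHs /andP[xs us] sA.
apply/andP; split; last by apply: IHs => // z zs; rewrite sA // inE zs orbT.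
by rewrite cA ?sA ?inE ?eqxx ?orbT //; apply: contraNneq xs => ->; rewrite inE eqxx.
Qed.

(** A path alternating between the sides, from [A] to [B], needs only [#|B|] vertices of [A]. *)
Lemma cov_complete b (A B : {set V}) : [disjoint A & B] -> #|B| <= #|A| ->
  {in A & B, forall u v, hue b u v} -> cov b 1 B.
Proof.
move=> dAB leBA cAB; set p := weave (take #|B| (enum A)) (enum B).
have szp : size (take #|B| (enum A)) = size (enum B).
  by rewrite size_takel -?cardE.
have sA x : x \in take #|B| (enum A) -> x \in A by move/mem_take; rewrite mem_enum.
apply: (cov_sub (leqnn 1) _ (cov_path (p := p) _)).
  by apply/subsetP => x xB; rewrite inE mem_weave // mem_enum xB orbT.
apply/andP; split.
  rewrite weave_uniq // cat_uniq take_uniq ?enum_uniq //= andbT.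
  apply/hasPn => x; rewrite mem_enum => xB; apply: contraTN xB => /sA.
  by move=> xA; rewrite (disjointFr dAB xA).
have sB x : x \in enum B -> x \in B by rewrite mem_enum.
rewrite /p; case: (take _ _) (enum B) szp sA sB => [|x xs] [|y ys] //= [sz] sA sB.
rewrite cAB ?sA ?sB ?mem_head // path_weave //; first exact: hue_sym.
by move=> u v ux vy; rewrite cAB ?sA ?sB // inE ux orbT.
Qed.

Lemma cov_pairs b i (A : {set V}) :
  {in A &, forall x y, x != y -> cov b 1 [set x; y]} -> #|A| <= 2 * i -> cov b i A.
Proof.
elim: i A => [|i IHi] A pA szA.
  rewrite (_ : A = set0); last by apply/eqP; rewrite -cards_eq0 -leqn0 -(muln0 2).
  by exists [::]; split=> // v; rewrite inE.
case: (leqP #|A| 1) => [A1|A1].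
  by apply: cov_sub (cov_singles b A) => //; lia.
have [x [y [xA yA xy]]] : exists x y, [/\ x \in A, y \in A & x != y].
  by case/card_gt1P: A1 => x [y [? ? ?]]; exists x, y.
have cardD : #|A :\: [set x; y]| <= 2 * i.
  rewrite cardsD (setIidPr _) ?cards2 ?xy; first by lia.
  by rewrite subUset !sub1set xA yA.
have := covU (pA x y xA yA xy) (IHi _ _ cardD); rewrite -[1 + i]/(i.+1).
move=> H; apply: (cov_sub (leqnn _) _ (H _)).
  by apply/subsetP => z zA; rewrite !inE zA andbT orbN.
by move=> u v /setDP[uA _] /setDP[vA _]; apply: pA.
Qed.

(* Gerencser and Gyarfas *)
Lemma two_path_partition :
  exists p q, [/\ mpath true p, mpath false q & forall v, (v \in p) || (v \in q)].
Proof.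
(* The induction keeps the two paths disjoint, so that the head of one can be moved onto the
   other. *)
suff [p [q [u sp sq pq]]] : exists p q, [/\ uniq (p ++ q), sorted (hue true) p,
    sorted (hue false) q & {subset enum V <= p ++ q}].
  move: u; rewrite cat_uniq => /and3P[up _ uq]; exists p, q; split; rewrite /mpath ?up ?uq //.
  by move=> v; rewrite -mem_cat pq // mem_enum.
elim: (enum V) => [|v s [p [q [u sp sq spq]]]]; first by exists [::], [::].
have [vin|vnin] := boolP (v \in p ++ q).
  by exists p, q; split=> // x; rewrite inE => /orP[/eqP->|/spq].
have add p' q' : perm_eq (p' ++ q') (v :: p ++ q) -> sorted (hue true) p' ->
    sorted (hue false) q' -> exists p q, [/\ uniq (p ++ q), sorted (hue true) p,
    sorted (hue false) q & {subset v :: s <= p ++ q}].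
  move=> pe s1 s2; exists p', q'; split=> //; first by rewrite (perm_uniq pe) /= vnin.
  by move=> x; rewrite (perm_mem pe) !inE => /orP[->|/spq->] //; rewrite orbT.
case: p => [|x p] in u sp spq vnin add *; first by apply: (add [:: v] q).
case: q => [|y q] in u sq spq vnin add *.
  by apply: (add (x :: p) [:: v]) => //; rewrite perm_catC /= cats0.
have [vx|vx] := boolP (hue true v x); first by apply: (add [:: v, x & p] (y :: q)) => //=; rewrite vx.
have [vy|vy] := boolP (hue false v y).
  by apply: (add (x :: p) [:: v, y & q]) => //=; [count_perm | rewrite vy].
(* Now [v x] is blue and [v y] is red. Whatever the colour of [x y], the path of that colour takes
   over the head of the other and then gains [v]. *)
rewrite hueN /= in vx; rewrite hueN /= in vy.
have [xy|xy] := boolP (hue true x y).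
  apply: (add [:: v, y, x & p] q) => //=; first by count_perm.
    by rewrite vy hue_sym xy.
  exact: path_sorted sq.
rewrite hueN /= in xy.
apply: (add p [:: v, x, y & q]); first by count_perm.
  exact: path_sorted sp.
by rewrite /= vx xy.
Qed.

(** * Depth-first search between two disjoint sets *)

Section Bipartite.
Variables (b : bool) (U W : {set V}).
Hypothesis dUW : [disjoint U & W].

Definition cross : rel V := fun u v =>
  hue b u v && ((u \in U) && (v \in W) || (u \in W) && (v \in U)).

(** Paths of [cross] alternate between [U] and [W]; the surplus of one occurs only if the first
    vertex is in [W]. *)
Lemma cross_count s :
  sorted cross s -> count (mem W) s <= (count (mem U) s).+1.
Proof.
suff H x t : path cross x t ->
    count (mem W) (x :: t) <= count (mem U) (x :: t) + (x \in W).
  by case: s => [|x s] // /H /leq_trans; apply; case: (x \in W); rewrite /=; lia.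
elim: t x => [|y t IHt] x /=; first by case: (x \in W) (x \in U) => [] [].
move=> /andP[/andP[_ xy] /IHt]; move: xy => /=.
have := disjointFr dUW (x := x); have := disjointFr dUW (x := y).
case: (x \in U); case: (x \in W); case: (y \in U); case: (y \in W) => //=; try lia.
all: by move=> h1 h2; try (by have := h1 isT); try (by have := h2 isT).
Qed.

(* Depth-first search in the hue b between U and W: F is the set of finished
   vertices, p the stack, and dfs_state is preserved until F reaches size a. *)
Definition dfs_state a (F : {set V}) (p : seq V) :=
  [/\ uniq p, sorted cross p, [disjoint F & p],
      {in F, forall u v, v \notin F -> v \notin p -> ~~ cross u v}
    & (#|F :&: U| <= a) && (#|F :&: W| <= a)].

(** The potential [2 * #|F| + size p] grows by one at each step: a push adds 1, and moving the top
    of the stack to [F] adds 2 - 1. *)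
Lemma dfs_progress a i : a <= #|U| ->
  exists F p, dfs_state a F p /\
    [\/ a <= #|F :&: U|, a <= #|F :&: W| | i <= 2 * #|F| + size p].
Proof.
move=> aU; elim: i => [|i [F [p [[up sp dFp Fp Fa] [h|h|ip]]]]].
- exists set0, [::]; split; last by constructor 3.
  by split=> //; [apply: disjointI => u; rewrite inE | move=> u; rewrite inE | rewrite !set0I cards0].
- by exists F, p; split=> //; constructor 1.
- by exists F, p; split=> //; constructor 2.
have [h|Ua] := leqP a #|F :&: U|; first by exists F, p; split=> //; constructor 1.
have [h|Wa] := leqP a #|F :&: W|; first by exists F, p; split=> //; constructor 2.
case: p => [|x p] in up sp dFp Fp ip *.
  (* With an empty stack the search restarts at a fresh vertex of [U], which exists as [F] contains
     fewer than [a] of them. *)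
  have [|v vU vFU] := @ex_outside _ U (F :&: U); first exact: leq_trans aU.
  have vF : v \notin F by apply: contra vFU; rewrite inE vU andbT.
  exists F, [:: v]; split; last by constructor 3; rewrite /= in ip *; lia.
  split=> //; first by apply: disjointI => u uF; rewrite inE; apply: contraNneq vF => <-.
  by move=> u uF w wF _; apply: Fp.
have [/existsP[y /and3P[yF yp xy]]|] := boolP [exists y, [&& y \notin F, y \notin x :: p & cross x y]].
  exists F, (y :: x :: p); split; last by constructor 3; rewrite /= in ip *; lia.
  have yx : cross y x by move: xy; rewrite /cross hue_sym orbC ![(_ \in _) && (y \in _)]andbC.
  split=> //; first by rewrite cons_uniq yp.
  - by rewrite /= yx.
  - apply: disjointI => u uF; rewrite inE negb_or (disjointFr dFp uF) andbT.
    by apply: contraNneq yF => <-.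
  - by move=> u uF w wF; rewrite inE negb_or => /andP[_]; apply: Fp.
rewrite negb_exists => /forallP Nx.
exists (x |: F), p; split; last first.
  constructor 3; rewrite cardsU1 /= in ip *.
  have -> : x \notin F by apply/negP => /(disjointFr dFp); rewrite inE eqxx.
  lia.
case/andP: up => xp up; split=> //; first exact: path_sorted sp.
- apply: disjointI => u /setU1P[->//|uF].
  by apply: contraFN (disjointFr dFp uF) => up'; rewrite inE up' orbT.
- move=> u /setU1P[->|uF] w; rewrite !inE negb_or => /andP[wx wF] wp.
    by have := Nx w; rewrite wF inE negb_or wx wp.
  by apply: Fp => //; rewrite inE negb_or wx.
- rewrite !setIUl; apply/andP; split.
    by rewrite (leq_trans (leq_card_setU _ _)) //;
      have := subset_leq_card (subsetIl [set x] U); rewrite cards1; lia.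
  by rewrite (leq_trans (leq_card_setU _ _)) //;
      have := subset_leq_card (subsetIl [set x] W); rewrite cards1; lia.
Qed.

(** The final stack is a path of hue [b]. If it has fewer than [m] vertices in [U], it has at most
    [m] in [W] and is discarded; no edge of hue [b] crosses between the finished vertices ([FU],
    [FW]) and the untouched ones ([TU], [TW]). *)
Lemma long_path_or_separation a m : a <= #|U| ->
  (exists A : {set V}, [/\ A \subset U, m <= #|A| & cov b 1 A]) \/
  exists FU FW TU TW : {set V},
    [/\ [/\ FU \subset U, FW \subset W, TU \subset U & TW \subset W],
        [/\ [disjoint FU & TU], [disjoint FW & TW],
            #|U| < #|FU| + #|TU| + m & #|W| <= #|FW| + #|TW| + m],
        [/\ #|FU| <= a, #|FW| <= a & (a <= #|FU|) || (a <= #|FW|)],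
        {in FU & TW, forall u v, hue (~~ b) u v}
      & {in TU & FW, forall u v, hue (~~ b) u v}].
Proof.
(* The potential is at most [2 * #|V|], so this target excludes the third outcome. *)
move=> /(dfs_progress (2 * #|V|).+1) [F [p [[up sp dFp Fp Fa] Ft]]].
set P := [set x in p].
have cP (A : {set V}) : #|A :&: P| = count (mem A) p.
  rewrite -size_filter -(card_uniqP (filter_uniq _ up)).
  by apply: eq_card => x; rewrite !inE mem_filter.
have mp : mpath b p by rewrite /mpath up; apply: sub_sorted sp => u v /andP[].
have [mU|Um] := leqP m #|U :&: P|.
  left; exists (U :&: P); split=> //; first exact: subsetIl.
  by apply: cov_sub (cov_path mp) => //; apply: subsetIr.
have Wm : #|W :&: P| <= m by rewrite cP (leq_trans (cross_count sp)) // -cP.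
right; exists (F :&: U), (F :&: W), (U :\: F :\: P), (W :\: F :\: P).
have dFD (A : {set V}) : [disjoint F :&: A & A :\: F :\: P].
  by apply: disjointI => x; rewrite !inE => /andP[-> _]; rewrite andbF.
have szD (A : {set V}) : #|A| <= #|F :&: A| + #|A :\: F :\: P| + #|A :&: P|.
  rewrite -(cardsID F A) [A :&: F]setIC -addnA leq_add2l.
  by rewrite -(cardsID P (A :\: F)) addnC leq_add2l subset_leq_card ?setSI ?subsetDl.
split.
- by split; rewrite ?subsetIr // setDDl subsetDl.
- by split=> //; have := szD U; have := szD W; lia.
- case/andP: Fa => -> ->; split=> //; case: Ft => [->//|->|]; first by rewrite orbT.
  have : #|F| + #|P| <= #|V|.
    rewrite -cardsUI (_ : F :&: P = set0) ?cards0 ?addn0 ?max_card //.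
    by apply/setP => x; rewrite !inE; apply/negP => /andP[/(disjointFr dFp)->].
  have -> : #|P| = size p by rewrite cardsE; apply/card_uniqP.
  lia.
- move=> u v; rewrite !inE => /andP[uF uU] /and3P[vp vF vW].
  by have := Fp u uF v vF vp; rewrite /cross uU vW /= andbT -hueN.
- move=> u v; rewrite !inE => /and3P[up' uF uU] /andP[vF vW].
  by have := Fp v vF u uF up'; rewrite /cross uU vW /= orbT andbT -hueN hue_sym.
Qed.

End Bipartite.

(** * The bipartite covering lemma *)

(** After a separation with [a = m], either [FU] has [m] vertices and at least [m] remain in [TW],
    or [FW] has [m] and more than [m] remain in [TU]; [cov_complete] applies to that pair. *)
Lemma balanced_step b (U W : {set V}) m :
  [disjoint U & W] -> 3 * m <= #|U| -> 3 * m <= #|W| ->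
  (exists A : {set V}, [/\ A \subset U, m <= #|A| & cov b 1 A]) \/
  (exists A : {set V}, [/\ A \subset W, m <= #|A| & cov (~~ b) 1 A]).
Proof.
move=> dUW mU mW.
have [||[FU [FW [TU [TW [sub [dU dW szU szW] [aU aW ge_a] cUW cWU]]]]]] :=
  long_path_or_separation b dUW (a := m) m; [lia | by left | right].
case: sub => sFU sFW sTU sTW; have {ge_a} [FUm|FWm] := orP ge_a.
  have [|A [_ sAT cardA]] := @subset_between V set0 TW m (sub0set _); first by rewrite cards0; lia.
  exists A; split; rewrite ?cardA ?(subset_trans sAT) //.
  apply: (cov_complete (A := FU)); rewrite ?cardA //.
    exact: disjointW sFU (subset_trans sAT sTW) dUW.
  by move=> u v uF vA; rewrite cUW // (subsetP sAT).
exists FW; split=> //; apply: (cov_complete (A := TU)) => //; last by lia.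
exact: disjointW sTU sFW dUW.
Qed.

(** With [a = #|W|], [TU] is larger than [FW], and either [FU] is at least as large as [TW] or [FW]
    is all of [W]. Two paths thus cover [FW] and [TW], and at most [m] discarded vertices of [W] are
    covered singly. *)
Lemma unbalanced_step b (U W : {set V}) m :
  [disjoint U & W] -> 2 * #|W| + m <= #|U| ->
  (exists A : {set V}, [/\ A \subset U, m <= #|A| & cov b 1 A]) \/
  cov (~~ b) m.+2 W.
Proof.
move=> dUW mU.
have [||[FU [FW [TU [TW [sub [dU dW szU szW] [aU aW ge_a] cUW cWU]]]]]] :=
  long_path_or_separation b dUW (a := #|W|) m; [lia | by left | right].
case: sub => sFU sFW sTU sTW.
have szFT : #|FW :|: TW| = #|FW| + #|TW| by rewrite cardsU disjoint_setI0 ?cards0 ?subn0.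
have sFT : FW :|: TW \subset W by rewrite subUset sFW.
have FTW : #|FW| + #|TW| <= #|W| by rewrite -szFT subset_leq_card.
have cF : cov (~~ b) 1 FW.
  by apply: (cov_complete (A := TU)) => //; [exact: disjointW sTU sFW dUW | lia].
have cT : cov (~~ b) 1 TW.
  apply: (cov_complete (A := FU)) => //; first exact: disjointW sFU sTW dUW.
  by case/orP: ge_a; lia.
apply: cov_sub (covU (covU cF cT) (cov_singles (~~ b) (W :\: (FW :|: TW)))).
  by rewrite cardsD (setIidPr sFT) szFT; lia.
by apply/subsetP => x xW; rewrite !inE xW; case: (x \in FW); case: (x \in TW).
Qed.

(** Greedy repetition of [balanced_step]: each path removes at least [m] vertices from its side,
    which bounds [a] and [d]. *)
Lemma balanced_iter b (U W : {set V}) m : 0 < m -> [disjoint U & W] ->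
  exists (U' W' : {set V}) a d,
    [/\ U' \subset U /\ W' \subset W, cov b a (U :\: U'), cov (~~ b) d (W :\: W'),
        a * m + #|U'| <= #|U| /\ d * m + #|W'| <= #|W|
      & #|U'| < 3 * m \/ #|W'| < 3 * m].
Proof.
move=> m0; have [n] := ubnP (#|U| + #|W|).
elim: n U W => // n IHn U W ltn dUW.
have cov0 b' (A : {set V}) : cov b' 0 (A :\: A).
  by exists [::]; split=> // v; rewrite setDv inE.
have [Um|Um] := ltnP #|U| (3 * m); first by exists U, W, 0, 0; split; rewrite ?mul0n; auto.
have [Wm|Wm] := ltnP #|W| (3 * m); first by exists U, W, 0, 0; split; rewrite ?mul0n; auto.
have [[A [sA mA cA]]|[A [sA mA cA]]] := balanced_step b dUW Um Wm.
  have cD : #|U :\: A| = #|U| - #|A| by rewrite cardsD (setIidPr sA).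
  have := subset_leq_card sA => AU.
  have [||U' [W' [a [d [[sU' sW'] ca cd [la ld] lt3]]]]] := IHn (U :\: A) W; first by lia.
    exact: disjointWl (subsetDl _ _) dUW.
  exists U', W', a.+1, d; split=> //; first by split=> //; exact: subset_trans sU' (subsetDl _ _).
    apply: cov_sub (covU cA ca) => //; apply/subsetP => x; rewrite !inE => /andP[-> ->].
    by rewrite andbT orbN.
  by split=> //; rewrite mulSn; lia.
have cD : #|W :\: A| = #|W| - #|A| by rewrite cardsD (setIidPr sA).
have := subset_leq_card sA => AU.
have [||U' [W' [a [d [[sU' sW'] ca cd [la ld] lt3]]]]] := IHn U (W :\: A); first by lia.
  exact: disjointWr (subsetDl _ _) dUW.
exists U', W', a, d.+1; split=> //; first by split=> //; exact: subset_trans sW' (subsetDl _ _).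
  apply: cov_sub (covU cA cd) => //; apply/subsetP => x; rewrite !inE => /andP[-> ->].
  by rewrite andbT orbN.
by split=> //; rewrite mulSn; lia.
Qed.

Lemma unbalanced_iter b (U W : {set V}) m : 0 < m -> [disjoint U & W] ->
  cov (~~ b) m.+2 W \/
  exists (U' : {set V}) a, [/\ U' \subset U, cov b a (U :\: U'),
    a * m + #|U'| <= #|U| & #|U'| < 2 * #|W| + m].
Proof.
move=> m0; have [n] := ubnP #|U|.
elim: n U => // n IHn U ltn dUW.
have [Um|Um] := ltnP #|U| (2 * #|W| + m).
  right; exists U, 0; split=> //.
  by exists [::]; split=> // v; rewrite setDv inE.
have [[A [sA mA cA]]|] := unbalanced_step b dUW Um; last by left.
have cD : #|U :\: A| = #|U| - #|A| by rewrite cardsD (setIidPr sA).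
have := subset_leq_card sA => AU.
have [|||[U' [a [sU' ca la lt]]]] := IHn (U :\: A); first by lia.
- exact: disjointWl (subsetDl _ _) dUW.
- by left.
right; exists U', a.+1; split=> //; first exact: subset_trans sU' (subsetDl _ _).
  apply: cov_sub (covU cA ca) => //; apply/subsetP => x; rewrite !inE => /andP[-> ->].
  by rewrite andbT orbN.
by rewrite mulSn; lia.
Qed.

(* M is the batch size of the last, balanced, round: its exact value is
   irrelevant, and as a variable it cannot be unfolded to a unary numeral. *)
Lemma cover_lopsided M k r s r' s' b (U W : {set V}) :
  100 * 100 * 100 * 100 * 10 <= M -> 100 * 100 * 10 * M <= k ->
  r <= k -> s <= k -> k <= 20 * r -> k <= 20 * s ->
  r' <= r -> s' <= s -> 999 * r <= 1000 * r' -> 999 * s <= 1000 * s' ->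
  [disjoint U & W] -> 100 * #|U| <= 99 * (r * s) -> #|W| < 3000 * k ->
  cov b r' U \/ cov (~~ b) s' W.
Proof.
move=> hM hk rk sk kr ks r'r s's r'999 s'999 dUW szU szW.
(* With batches of size [s' - 2], the alternative outcome covers [W] with exactly [s'] paths. *)
have m2 : 0 < s' - 2 by lia.
have [cW|[U2 [a2 [sU2 c2 la2 szU2]]]] := unbalanced_iter b m2 dUW.
  by right; apply: cov_sub cW => //; lia.
(* Both sides now have size O(k). Batches of size [M] cost O(k / M) paths and leave fewer than
   [3 * M] single vertices on one side, both negligible against [k]. *)
have M0 : 0 < M by lia.
have [U3 [W3 [a3 [d3 [[sU3 sW3] ca cd [la3 ld3] lt3]]]]] :=
  balanced_iter b M0 (disjointWl sU2 dUW).
(* Each of the [a2] paths takes almost [s] vertices of a set of size at most [0.99 r s]; the rest of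
   the budget [r'] pays for the last round. *)
have a2r : 998 * a2 <= 990 * r.
  have s0 : 0 < s by lia.
  rewrite -(leq_pmul2r s0).
  have : a2 * (998 * s) <= a2 * (1000 * (s' - 2)) by rewrite leq_mul2l; apply/orP; right; lia.
  by lia.
have a3k : a3 * (100 * 100 * 100 * 100 * 10) <= a3 * M by rewrite leq_mul2l hM orbT.
have d3k : d3 * (100 * 100 * 100 * 100 * 10) <= d3 * M by rewrite leq_mul2l hM orbT.
have sUD (A B C : {set V}) : A \subset (A :\: B) :|: ((B :\: C) :|: C).
  by apply/subsetP => x xA; rewrite !inE xA; case: (x \in B); case: (x \in C).
case: lt3 => [U3M|W3M]; [left|right].
  apply: cov_sub (covU c2 (covU ca (cov_singles b U3))); last exact: sUD.
  by lia.
apply: cov_sub (covU cd (cov_singles (~~ b) W3)); first by lia.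
by apply: subset_trans (sUD W W W3) _; rewrite setDv set0U.
Qed.

Lemma cover_bipartite M k r s b (U W : {set V}) :
  100 * 100 * 100 * 100 * 10 <= M -> 100 * 100 * 10 * M <= k ->
  r <= k -> s <= k -> k <= 20 * r -> k <= 20 * s ->
  [disjoint U & W] -> 100 * #|U| <= 99 * (r * s) -> 100 * #|W| <= 99 * (r * s) ->
  cov b r U \/ cov (~~ b) s W.
Proof.
move=> hM hk rk sk kr ks dUW szU szW.
have k0 : 0 < k by lia.
(* Batches of [1000 * k] use at most a thousandth of each budget and bring one side below
   [3000 * k], as [cover_lopsided] requires. *)
have m0 : 0 < 1000 * k by lia.
have [U1 [W1 [a [d [[sU sW] ca cd [la ld] lt1]]]]] := balanced_iter b m0 dUW.
have ar : 1000 * a <= r.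
  rewrite -(leq_pmul2r k0).
  have : r * s <= r * k by rewrite leq_mul2l sk orbT.
  by lia.
have ds : 1000 * d <= s.
  rewrite -(leq_pmul2r k0).
  have : r * s <= k * s by rewrite leq_mul2r rk orbT.
  by lia.
have dUW1 := disjointW sU sW dUW.
have [szU1 szW1] := (subset_leq_card sU, subset_leq_card sW).
suff [c1|c1] : cov b (r - a) U1 \/ cov (~~ b) (s - d) W1.
- left; apply: cov_sub (covU ca c1); first by lia.
  by apply/subsetP => x xU; rewrite !inE xU andbT orNb.
- right; apply: cov_sub (covU cd c1); first by lia.
  by apply/subsetP => x xU; rewrite !inE xU andbT orNb.
case: lt1 => lt1.
  (* The small side is [U1], so the sides and the hues exchange roles. *)
  rewrite disjoint_sym in dUW1.
  suff [c1|c1] : cov (~~ b) (s - d) W1 \/ cov (~~ ~~ b) (r - a) U1.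
  - by right.
  - by left; rewrite negbK in c1.
  by apply: (cover_lopsided (M := M) (k := k) (r := s) (s := r)) => //; lia.
by apply: (cover_lopsided (M := M) (k := k) (r := r) (s := s)) => //; lia.
Qed.

(** * Longest paths, segments and rotation *)

(** Keeping the vertices of [q0] ensures that a path covering the complement of [q0] also covers
    that of [q]. *)
Lemma longest_mpath b q0 : mpath b q0 ->
  exists q, [/\ mpath b q, {subset q0 <= q}
    & forall q', mpath b q' -> {subset q <= q'} -> size q' <= size q].
Proof.
move=> mq0; pose P n := [exists t : n.-tuple V, mpath b t && all [in t] q0].
have exP : exists n, P n.
  exists (size q0); apply/existsP; exists (in_tuple q0); rewrite mq0 /=; exact/allP.
have leP n : P n -> n <= #|V|.
  by case/existsP=> t /andP[/andP[/card_uniqP sz _] _]; rewrite -(size_tuple t) -sz max_card.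
case: (ex_maxnP exP leP) => n /existsP[t /andP[mt /allP qt]] maxn.
exists t; split=> // q' mq' tq'; rewrite size_tuple; apply: maxn.
apply/existsP; exists (in_tuple q'); rewrite mq' /=.
by apply/allP => x /qt/tq'.
Qed.

Lemma path_split (T : eqType) (q : seq T) y z : y \in q -> z \in q -> y != z ->
  exists q1 m q2, q = q1 ++ y :: m ++ z :: q2 \/ q = q1 ++ z :: m ++ y :: q2.
Proof.
case/splitPr=> q1 q2; rewrite mem_cat inE => /or3P[||] + yz.
- by case/splitPr=> m1 m2; exists m1, m2, q2; right; rewrite -catA.
- by move/eqP=> zy; rewrite zy eqxx in yz.
- by case/splitPr=> m1 m2; exists q1, m1, m2; left.
Qed.

(** The segment of [q] between [y] and [y'], extended by [x] at one end and [x'] at the other, is a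
    path. *)
Lemma cov_path_segment b q x y x' y' : mpath b q -> y \in q -> y' \in q -> y != y' ->
  x \notin q -> x' \notin q -> x != x' -> hue b x y -> hue b x' y' ->
  cov b 1 [set x; x'].
Proof.
move=> mq yq y'q yy'; have [q1 [m [q2 Eq]]] := path_split yq y'q yy'.
have {yq y'q yy'} main u v z w : mpath b (q1 ++ z :: m ++ w :: q2) ->
    u \notin q1 ++ z :: m ++ w :: q2 -> v \notin q1 ++ z :: m ++ w :: q2 -> u != v ->
    hue b u z -> hue b v w -> cov b 1 [set u; v].
  rewrite -cat_cons -cat_rcons; move Es: (rcons _ w) => s /andP[].
  rewrite !cat_uniq !mem_cat !negb_or => /and3P[_ _ /and3P[us _ _]].
  move=> /cat_sorted2[_ /cat_sorted2[ss _]] /and3P[_ u_s _] /and3P[_ v_s _] uv uz vw.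
  have mp : mpath b (u :: rcons s v).
    rewrite /mpath cons_uniq rcons_uniq mem_rcons inE negb_or uv u_s v_s us.
    rewrite -Es /= rcons_path last_rcons [hue b w v]hue_sym vw andbT uz.
    by move: ss; rewrite -Es.
  apply: cov_sub (cov_path mp) => //; apply/subsetP => t.
  by rewrite !inE => /orP[]/eqP->; rewrite ?eqxx ?mem_rcons ?inE ?eqxx ?orbT.
case: Eq => Eq xq x'q xx' xy x'y'; rewrite Eq in mq xq x'q.
  exact: main mq xq x'q xx' xy x'y'.
by rewrite setUC; apply: main mq x'q xq _ x'y' xy; rewrite eq_sym.
Qed.

(* Posa rotation: in a maximal path, the successors of the neighbours of an
   outside vertex span a clique of the other hue. *)
Lemma successor_clique b q x : mpath b q ->
  (forall q', mpath b q' -> {subset q <= q'} -> size q' <= size q) -> x \notin q ->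
  exists C : {set V}, [/\ C \subset [set y in q],
    {in C &, forall u v, u != v -> hue (~~ b) u v}
    & #|[set y in q | hue b x y]| <= #|C|.+1].
Proof.
move=> mq maxq xq; set N := [set y in q | _].
(* [f u] is the successor of [u] on [q]. The last vertex has none and is left out of [N'], whence
   the loss of one in the bound. *)
pose f u := nth x q (index u q).+1; pose N' := N :\ last x q.
have [uq sq] := andP mq.
have idx q1 u q2 : q = q1 ++ u :: q2 -> index u q = size q1.
  move=> Eq; have : u \notin q1.
    by move: uq; rewrite Eq cat_uniq /= negb_or => /and3P[_ /andP[]].
  by rewrite Eq index_cat /= eqxx addn0 => /negPf->.
have fE q1 u q2 : q = q1 ++ u :: q2 -> f u = head x q2.
  by move=> Eq; rewrite /f (idx _ _ _ Eq) Eq nth_cat ltnNge leqnSn subSnn /= nth0.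
have ne_last q1 u q2 : q = q1 ++ u :: q2 -> u \in N' -> q2 != [::].
  by move=> Eq; rewrite !inE; case: q2 Eq => // ->; rewrite last_cat /= eqxx.
have f_split u : u \in N' -> exists q1 v q2, q = q1 ++ [:: u, v & q2] /\ f u = v.
  move=> uN; have [q1 [q2 Eq]] : exists q1 q2, q = q1 ++ u :: q2.
    have : u \in q by move: uN; rewrite !inE => /and3P[].
    by case/splitPr=> q1 q2; exists q1, q2.
  case: q2 Eq (ne_last _ _ _ Eq uN) => // v q2 Eq _; exists q1, v, q2; split=> //.
  by rewrite (fE _ _ _ Eq).
have inj_f : {in N' &, injective f}.
  have f_lt u : u \in N' -> (index u q).+1 < size q /\ u \in q.
    move=> /f_split[q1 [v [q2 [Eq _]]]]; rewrite (idx _ _ _ Eq).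
    by rewrite Eq size_cat mem_cat !inE eqxx orbT /=; split=> //; lia.
  move=> u v /f_lt[ltu uq'] /f_lt[ltv vq'] /eqP.
  by rewrite nth_uniq // eqSS => /eqP/(congr1 (nth x q)); rewrite !nth_index.
have crossing u v : u \in N' -> v \in N' -> (exists q1 m q2, q = q1 ++ u :: m ++ v :: q2) ->
    hue (~~ b) (f u) (f v).
  move=> uN vN [q1 [m [[|w q2] Eq]]]; last first.
    rewrite -hueN; apply/negP; rewrite (fE _ _ _ Eq).
    have -> : f v = w by rewrite (fE (q1 ++ u :: m) v (w :: q2)) // Eq -catA.
    move: uN vN; rewrite !inE => /and3P[_ _ ux] /and3P[_ _ vx] mw.
    (* The path runs to [u], through [x] to [v], back along [m] to the successor of [u], then jumps
       to the successor [w] of [v]. It is one vertex longer than [q]. If [m] is empty, the jump is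
       the edge [v w] of [q] itself. *)
    pose q' := q1 ++ [:: u, x, v & rev m ++ w :: q2].
    have pe : perm_eq q' (x :: q).
      by rewrite Eq; apply/permP => a; rewrite /q' /= !count_cat /= !count_cat count_rev /=; ring.
    have : size q' <= size q.
      apply: maxq; last by move=> z zq; rewrite (perm_mem pe) inE zq orbT.
      rewrite /mpath (perm_uniq pe) /= xq uq /=; move: sq.
      rewrite Eq !sorted_cat /= => /and3P[-> + ->]; rewrite andbT /=.
      rewrite cat_path /= => /and4P[pm mv vw pw].
      rewrite [hue b u x]hue_sym ux vx cat_path /= pw andbT.
      case: m {Eq pe q'} pm mv mw => [|z m] /=; first by rewrite vw.
      move=> /andP[_ pm] mv zw; rewrite rev_cons last_rcons zw andbT -rev_cons.
      have : path (hue b) z (rcons m v) by rewrite rcons_path pm mv.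
      rewrite -rev_path last_rcons belast_rcons.
      by apply: sub_path => s t; rewrite hue_sym.
    by rewrite (perm_size pe) /= ltnn.
  by have := ne_last (q1 ++ u :: m) v [::]; rewrite -catA -Eq => /(_ erefl vN).
exists (f @: N'); split.
- apply/subsetP => _ /imsetP[u /f_split[q1 [v [q2 [Eq ->]]]] ->].
  by rewrite inE Eq mem_cat !inE eqxx !orbT.
- move=> _ _ /imsetP[u uN ->] /imsetP[v vN ->] fuv.
  have uv : u != v by apply: contraNneq fuv => ->.
  have [uq' vq'] : u \in q /\ v \in q.
    by move: uN vN; rewrite !inE => /and3P[_ -> _] /and3P[_ -> _].
  have [q1 [m [q2 [Eq|Eq]]]] := path_split uq' vq' uv.
    by apply: crossing => //; exists q1, m, q2.
  by rewrite hue_sym; apply: crossing => //; exists q1, m, q2.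
- rewrite card_in_imset // (cardsD1 (last x q) N) -/N'.
  by case: (_ \in N); rewrite ?add1n ?add0n ?leqnSn.
Qed.

(** * Saving paths by pairing outside vertices *)

(** The path [q], [i] pairs and single vertices for the rest make [1 + #|~: [set x in q]| - i]
    paths. *)
Lemma cov_save_pairs b q (A : {set V}) i k : mpath b q ->
  {in A &, forall x y, x != y -> cov b 1 [set x; y]} ->
  A \subset ~: [set x in q] -> #|A| = 2 * i ->
  #|~: [set x in q]| < k + i -> cov b k setT.
Proof.
move=> mq pA sA cardA ltk.
have cA : cov b i A by apply: cov_pairs => //; rewrite cardA.
apply: cov_sub (covU (cov_path mq) (covU cA (cov_singles b (~: [set x in q] :\: A)))).
  rewrite cardsD (setIidPr sA) cardA; have := subset_leq_card sA; rewrite cardA; lia.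
by apply/subsetP => x _; rewrite !inE; case: (x \in q); case: (x \in A).
Qed.

(** A matching, encoded as an injective [f] on [T], is extended greedily. When it cannot grow, [T]
    and its image meet every edge of hue [b] between [X] and [Y]. *)
Lemma matching_or_separation b (X Y : {set V}) i :
  (exists (T : {set V}) f, [/\ T \subset X, #|T| = i, {in T &, injective f},
      {in T, forall t, f t \in Y} & {in T, forall t, hue b t (f t)}]) \/
  (exists T B : {set V}, [/\ T \subset X, B \subset Y, #|T| < i, #|B| < i
      & {in X :\: T & Y :\: B, forall x y, hue (~~ b) x y}]).
Proof.
elim: i => [|i [[T [f [sTX cardT injf fY bf]]]|[T [B [? ? ? ? ?]]]]].
- by left; exists set0, id; split; rewrite ?sub0set ?cards0 // => x; rewrite inE.
- have [/existsP[x /existsP[y /and3P[xT yB xy]]]|] := boolP [exists x, exists y,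
    [&& x \in X :\: T, y \in Y :\: f @: T & hue b x y]].
    left; move: xT yB; rewrite !inE => /andP[xT xX] /andP[yB yY].
    pose g z := if z == x then y else f z.
    have gT z : z \in T -> g z = f z by rewrite /g => zT; case: eqP zT xT => [->->|].
    have gx : g x = y by rewrite /g eqxx.
    have fT z : z \in T -> f z != y by move=> zT; apply: contraNneq yB => <-; apply: imset_f.
    exists (x |: T), g; split.
    + by rewrite subUset sub1set xX.
    + by rewrite cardsU1 xT cardT.
    + move=> u v /setU1P[->|uT] /setU1P[->|vT] //; rewrite ?gx ?gT //; last exact: injf.
        by move=> E; have := fT v vT; rewrite -E eqxx.
      by move=> E; have := fT u uT; rewrite E eqxx.
    + by move=> u /setU1P[->|uT]; rewrite ?gx ?gT ?fY.
    + by move=> u /setU1P[->|uT]; rewrite ?gx ?gT ?bf.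
  move=> /existsPn nxy; right; exists T, (f @: T); split=> //.
  + by apply/subsetP => _ /imsetP[t tT ->]; apply: fY.
  + by rewrite cardT.
  + by rewrite (leq_ltn_trans (leq_imset_card _ _)) ?cardT.
  + move=> x y xX yY; have /existsPn/(_ y) := nxy x.
    by rewrite xX yY hueN.
- by right; exists T, B; split=> //; exact: ltnW.
Qed.

(** * Threading paths through a fixed set *)

(** Links are chosen greedily: two consecutive vertices of [t0 :: ts] exclude at most [2 * D]
    candidates, and earlier links at most [size ts] more. *)
Lemma chain b D t0 ts (A : {set V}) : 2 * D + size ts < #|A| ->
  {in t0 :: ts, forall t, #|[set y in A | hue (~~ b) t y]| <= D} ->
  exists r0 rs, [/\ size rs = size ts, uniq (r0 :: rs), {subset r0 :: rs <= A},
    hue b t0 r0 & path (hue b) r0 (weave ts rs)].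
Proof.
elim: ts t0 A => [|t ts IHts] t0 A /= ltA few.
  have [|r rA] := @ex_outside _ A [set y in A | hue (~~ b) t0 y].
    by apply: leq_ltn_trans (few t0 (mem_head _ _)) _; lia.
  rewrite inE rA -hueN negbK /= => t0r.
  by exists r, [::]; split=> // x; rewrite inE => /eqP->.
pose N t := [set y in A | hue (~~ b) t y].
have [|r rA] := @ex_outside _ A (N t0 :|: N t).
  apply: leq_ltn_trans (leq_card_setU _ _) _.
  apply: leq_ltn_trans (leq_add (few t0 _) (few t _)) _; rewrite ?inE ?eqxx ?orbT //.
  by lia.
rewrite !inE rA -!hueN /= negb_or !negbK => /andP[t0r tr].
have [||r1 [rs [sz ur sr tr1 pr]]] := IHts t (A :\ r).
- by move: ltA; rewrite (cardsD1 r A) rA add1n addnS ltnS.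
- move=> u uin; apply: leq_trans (few u _); last by rewrite inE uin orbT.
  by apply/subset_leq_card/subsetP => y; rewrite !inE => /andP[/andP[_ ->]].
exists r, (r1 :: rs); split.
- by rewrite /= sz.
- by apply/andP; split; [apply/negP => /sr; rewrite !inE eqxx | exact: ur].
- by move=> x; rewrite inE => /orP[/eqP->//|/sr]; rewrite inE => /andP[].
- by [].
- by rewrite /= pr [hue b r t]hue_sym tr tr1.
Qed.

(** Every chain passes through the whole of [S] and picks up [#|S|] new vertices of [A]; reusing [S]
    is harmless, as paths may overlap. *)
Lemma cov_chains b D (S A : {set V}) : 0 < #|S| -> [disjoint S & A] ->
  {in S, forall t, #|[set y in A | hue (~~ b) t y]| <= D} ->
  exists (A' : {set V}) p, [/\ A' \subset A, cov b p (A :\: A'),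
    p * #|S| + #|A'| <= #|A| & #|A'| < 2 * D + #|S|].
Proof.
move=> S0; have [n] := ubnP #|A|; elim: n A => // n IHn A ltn dSA few.
have [small|big] := ltnP #|A| (2 * D + #|S|).
  exists A, 0; split=> //; exists [::]; split=> // v; by rewrite setDv inE.
have [t0 [ts Es]] : exists t0 ts, enum S = t0 :: ts.
  by move: S0; rewrite cardE; case: (enum S) => // t0 ts; exists t0, ts.
have szS : #|S| = (size ts).+1 by rewrite cardE Es.
have sS : {subset t0 :: ts <= S} by move=> t; rewrite -Es mem_enum.
have [||r0 [rs [sz ur sr t0r pr]]] := @chain b D t0 ts A; first by move: big; rewrite szS addnS.
  by move=> t /sS/few.
have cardR : #|[set x in r0 :: rs]| = #|S|.
  by rewrite cardsE; move/card_uniqP: ur => ->; rewrite szS /= sz.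
have sRA : [set x in r0 :: rs] \subset A by apply/subsetP => x; rewrite inE => /sr.
have mp : mpath b (t0 :: r0 :: weave ts rs).
  rewrite /mpath /= t0r pr andbT -/(uniq (t0 :: r0 :: weave ts rs)).
  have pe : perm_eq (t0 :: r0 :: weave ts rs) ((t0 :: ts) ++ (r0 :: rs)).
    apply/permP => a; have /permP/(_ a) /= := perm_weave (esym sz); rewrite !count_cat /= => ->; ring.
  rewrite (perm_uniq pe) cat_uniq ur andbT -Es enum_uniq andTb andbT.
  by apply/hasPn => x /sr xA; rewrite /= mem_enum (disjointFl dSA xA).
have [|||A' [p [sA' cA' lA' ltA']]] := IHn (A :\: [set x in r0 :: rs]).
- by rewrite cardsD (setIidPr sRA) cardR; lia.
- exact: disjointWr (subsetDl _ _) dSA.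
- move=> t /few; apply: leq_trans; apply/subset_leq_card/subsetP => y.
  by rewrite !inE => /andP[/andP[_ ->]].
exists A', p.+1; split=> //; first exact: subset_trans sA' (subsetDl _ _).
  apply: cov_sub (covU (cov_path mp) cA') => //; apply/subsetP => x.
  rewrite !inE mem_weave // => /andP[-> ->] /=.
  by case: (x == r0); case: (x \in rs); rewrite ?orbT.
by move: lA'; rewrite cardsD (setIidPr sRA) cardR mulSn; lia.
Qed.

(** * Paths of greatest yield through a whole set *)

Section TightCover.
Variables (b : bool) (D : nat) (T X R : {set V}).
Hypotheses (dTX : [disjoint T & X]) (dR : [disjoint R & T :|: X])
  (cXR : {in X & R, forall x y, hue b x y})
  (fewT : {in T, forall t, #|[set y in R | hue (~~ b) t y]| <= D}).

(** The path first threads [T] through [r0 :: rs], then alternates between [X] and [L], and ends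
    with [x], [e]. Starting and ending outside [T :|: X], it gains [#|T| + #|X| + 1] vertices there,
    the most an alternating path can. *)
Lemma cov_threaded e x r0 rs (L : {set V}) :
  e \notin R -> e \notin T :|: X -> x \in X -> hue b x e ->
  size rs = #|T| -> uniq (r0 :: rs) -> {subset r0 :: rs <= R} ->
  path (hue b) r0 (weave (enum T) rs) ->
  L \subset R :\: [set y in r0 :: rs] -> #|L|.+1 = #|X| ->
  cov b 1 (e |: [set y in r0 :: rs] :|: L :|: (T :|: X)).
Proof.
move=> eR eTX xX xe szr ur sr pr sL szL.
set xs := enum (X :\ x); set ys := enum L; set ts := enum T.
have sxy : size xs = size ys.
  by rewrite -!cardE; apply/eqP; rewrite -eqSS szL (cardsD1 x X) xX add1n.
have str : size ts = size rs by rewrite -cardE.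
have ys_R y : y \in ys -> y \in R by rewrite mem_enum => /(subsetP sL); rewrite inE => /andP[].
set p := r0 :: weave (ts ++ rcons xs x) (rs ++ rcons ys e).
have pe : perm_eq p ((ts ++ rcons xs x) ++ (r0 :: rs ++ rcons ys e)).
  rewrite perm_sym (perm_catCA _ [:: r0]) perm_cons perm_sym perm_weave //.
  by rewrite !size_cat !size_rcons str sxy.
have sp : sorted (hue b) p.
  rewrite /p /= -!cats1 !weave_cat // !cat_path pr /= last_weave //.
  have lR : last r0 rs \in R by apply: sr; apply: mem_last.
  rewrite path_weave //=; last 2 first.
  - exact: hue_sym.
  - move=> u v; rewrite mem_enum !inE => /andP[_ uX] /orP[/eqP->|/ys_R]; exact: cXR.
  rewrite last_weave // hue_sym xe andbT cXR //.
  by case: (lastP ys) ys_R => //= s z sR; rewrite last_rcons sR // mem_rcons mem_head.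
have up : uniq p.
  rewrite (perm_uniq pe) -cat_cons; apply/uniq_catP; split.
  - apply/uniq_catP; split=> [||z]; first exact: enum_uniq.
      by rewrite rcons_uniq enum_uniq mem_enum !inE eqxx.
    rewrite mem_rcons inE !mem_enum !inE => zin.
    have zX : z \in X by case/orP: zin => [/eqP->|/andP[]].
    by rewrite (disjointFl dTX zX).
  - apply/uniq_catP; split=> [||z] //.
      by rewrite rcons_uniq enum_uniq mem_enum andbT; apply: contra eR => /(subsetP sL)/setDP[].
    rewrite mem_rcons inE => /orP[/eqP->|]; first by apply: contra eR => /sr.
    by rewrite mem_enum => /(subsetP sL)/setDP[_]; rewrite inE.
  - move=> z zR; rewrite mem_cat mem_rcons inE !mem_enum !inE.
    have zTX : z \notin T :|: X.
      move: zR; rewrite mem_cat mem_rcons inE => /or3P[/sr zR|/eqP->//|/ys_R zR].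
        by rewrite (disjointFr dR zR).
      by rewrite (disjointFr dR zR).
    move: zTX; rewrite !inE; case: (z \in T) => //=; case: eqP => [->|_]; rewrite ?xX // => /negPf->.
apply: cov_sub (cov_path (p := p) _) => //; last by rewrite /mpath up.
apply/subsetP => z zin; rewrite inE (perm_mem pe).
rewrite !(mem_cat, mem_rcons, inE) !mem_enum !inE; move: zin; rewrite !inE.
by case: (z == e); case: (z == r0); case: (z \in rs); case: (z \in L); case: (z \in T);
  case: (z \in X); case: (z == x).
Qed.

(** The links [C] around [T] are fixed first, since choosing them needs [2 * D] spare vertices. The
    set [L] is arbitrary afterwards: [X] is completely joined to [R], so its share needs no slack
    and nothing has to be left over. *)
Lemma cov_threaded_family es (A : {set V}) :
  0 < #|X| ->
  {in es, forall e,
    [/\ e \notin R, e \notin T :|: X & exists2 x, x \in X & hue b x e]} ->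
  A \subset R -> 2 * D + size es * #|T|.+1 <= #|A| -> #|T| + #|X| <= #|R| ->
  exists C : {set V}, [/\ C \subset A, #|C| = size es * #|T|.+1
    & forall L : {set V}, L \subset R :\: C -> #|L| <= size es * #|X|.-1 ->
      cov b (size es) ([set e in es] :|: C :|: L :|: (if es is [::] then set0 else T :|: X))].
Proof.
move=> X0; elim: es A => [|e es IHes] A ines sAR ltA ltR.
  exists set0; split; rewrite ?sub0set ?cards0 // => L _; rewrite leqn0 cards_eq0 => /eqP->.
  by exists [::]; split=> // v; rewrite !inE.
have [eR eTX [x xX xe]] := ines e (mem_head _ _).
have szT : size (enum T) = #|T| by rewrite -cardE.
(* [x] merely serves as start vertex for [chain]: its edge to [r0] is dropped, because [x] stands
   near the end of the final path. *)
have [||r0 [rs [sz ur sr _ pr]]] := @chain b D x (enum T) A.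
- by rewrite szT -addnS; apply: leq_trans ltA; rewrite leq_add2l leq_pmull.
- move=> t; rewrite inE mem_enum => /orP[/eqP->|tT].
    rewrite (_ : [set y in A | _] = set0) ?cards0 //.
    by apply/setP => y; rewrite !inE -hueN; apply/negP => /andP[/(subsetP sAR) yR]; rewrite cXR.
  by apply: leq_trans (fewT tT); apply/subset_leq_card/subsetP => y;
    rewrite !inE => /andP[/(subsetP sAR)-> ->].
set C0 := [set y in r0 :: rs].
have cardC0 : #|C0| = #|T|.+1 by rewrite cardsE; move/card_uniqP: ur => ->; rewrite /= sz szT.
have sC0 : C0 \subset A by apply/subsetP => y; rewrite inE => /sr.
have [|||//|C [sC cardC covC]] := IHes (A :\: C0).
- by move=> f fes; apply: ines; rewrite inE fes orbT.
- exact: subset_trans (subsetDl _ _) sAR.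
- rewrite cardsD (setIidPr sC0) cardC0; move: ltA.
  rewrite [size (e :: es) * _]mulSn addnCA => ltA.
  by rewrite leq_subRL // (leq_trans _ ltA) // leq_addr.
have dC0C : C0 :&: C = set0.
  by apply/setP => y; rewrite !inE; apply/negP => /andP[yC0 /(subsetP sC)]; rewrite !inE yC0.
exists (C0 :|: C); split.
- by rewrite subUset sC0 (subset_trans sC) ?subsetDl.
- by rewrite cardsU dC0C cards0 subn0 cardC0 cardC /= mulSn.
move=> L sL szL.
have [|L0 [_ sL0 cardL0]] := @subset_between V set0 L (minn #|L| #|X|.-1) (sub0set _).
  by rewrite cards0 geq_minl.
have cardD : #|L :\: L0| <= size es * #|X|.-1.
  rewrite cardsD (setIidPr sL0) cardL0 leq_subLR; move: szL.
  rewrite [size (e :: es) * _]mulSn /minn; case: ifP => _ //.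
  by rewrite leq_addr.
have sLC : L :\: L0 \subset R :\: C.
  apply/subsetP => y /setDP[/(subsetP sL)]; rewrite !inE negb_or => /andP[/andP[_ ->] ->] //.
(* [L0] is padded to exactly [#|X|.-1] vertices; the padding may overlap other paths. *)
have [||L1 [sL01 sL1 cardL1]] := @subset_between V L0 (R :\: C0) #|X|.-1.
- apply: subset_trans sL0 (subset_trans sL _).
  by apply/subsetP => y; rewrite !inE negb_or => /andP[/andP[-> _] ->].
- rewrite cardL0 geq_minr cardsD (setIidPr (subset_trans sC0 sAR)) cardC0 andTb.
  have ltR' : #|T|.+1 + #|X|.-1 <= #|R| by rewrite addSnnS prednK.
  by rewrite leq_subRL // (leq_trans _ ltR') // leq_addr.
have c0 : cov b 1 (e |: C0 :|: L1 :|: (T :|: X)).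
  apply: (cov_threaded eR eTX xX xe _ ur _ pr sL1) => //; first by rewrite sz szT.
    by move=> y /sr/(subsetP sAR).
  by rewrite cardL1 prednK.
apply: cov_sub (covU c0 (covC _ sLC cardD)) => //.
apply/subsetP => y yin; have := subsetP sL01 y; move: yin.
case: es {IHes ines ltA cardC covC szL cardD} => [|e' es]; rewrite !inE.
  by case: (y \in L0) => [+ /(_ isT)->|+ _]; case: (y \in L1); case: (y == e); case: (y == r0);
    case: (y \in rs);    case: (y \in L); case: (y \in T); case: (y \in X); case: (y \in C).
by case: (y \in L0) => [+ /(_ isT)->|+ _]; case: (y \in L1); case: (y == e); case: (y == r0);
    case: (y \in rs);  case: (y \in L); case: (y \in T); case: (y \in X); case: (y \in C); case: (y == e'); case: (y \in es).
Qed.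

End TightCover.

(** * One path containing almost all vertices *)

Section OneLongPath.
Variables (M k : nat) (b : bool) (q : seq V).
Hypotheses (hM : 100 * 100 * 100 * 100 * 10 <= M) (hk : 100 * 100 * 10 * M <= k)
  (n_lb : k * k <= #|V|) (n_ub : #|V| <= k * k + 2 * k).

Let k_big : 100 * 100 * 100 <= k. Proof. lia. Qed.

Let Q := [set x in q].
Hypotheses (mq : mpath b q) (cQ' : cov (~~ b) 1 (~: Q)) (few_out : 50 * #|~: Q| <= #|V|).

Let cardQ : #|Q| + #|~: Q| = #|V|. Proof. exact: cardsC. Qed.

Let dQ (A B : {set V}) : A \subset Q -> B \subset ~: Q -> [disjoint A & B].
Proof. by move=> sA sB; apply: disjointW sA sB _; rewrite -setI_eq0 setICr. Qed.

(** One path for [C] and one for [~: Q] leave [k - 2] for [Q :\: C]; in the other hue, [q] leaves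
    [k - 1] for [~: Q]. Removing the fortieth of the vertices that lies in [C] makes room for
    [cover_bipartite]. *)
Lemma cov_by_clique (C : {set V}) : C \subset Q ->
  {in C &, forall u v, u != v -> hue (~~ b) u v} -> #|V| <= 40 * #|C|.+1 ->
  exists b', cov b' k setT.
Proof.
move=> sC cC szC.
have szQC : #|Q :\: C| = #|Q| - #|C| by rewrite cardsD (setIidPr sC).
have dQC : [disjoint Q :\: C & ~: Q] by apply: dQ; rewrite ?subsetDl.
have arith n u d w : k * k <= n -> n <= k * k + 2 * k -> n <= 40 * d.+1 ->
    u + w = n -> 50 * w <= n ->
    100 * (u - d) <= 99 * ((k - 2) * (k - 1)) /\ 100 * w <= 99 * ((k - 2) * (k - 1)).
  move: k k_big; clear; move=> [|[|r]]; [lia|lia|].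
  have -> : r.+2 - 2 = r by lia.
  have -> : r.+2 - 1 = r.+1 by lia.
  move=> big; have big2 : 100 * 100 * r <= r * r by rewrite leq_mul2r; apply/orP; right; lia.
  by move=> *; split; lia.
have [szU szW] := arith _ _ _ _ n_lb n_ub szC cardQ few_out.
rewrite -szQC in szU.
have [||||c1|c1] := cover_bipartite (~~ b) hM hk _ _ _ _ dQC szU szW; try lia.
  exists (~~ b); apply: cov_sub (covU c1 (covU (cov_clique cC) cQ')); first by lia.
  by apply/subsetP => x _; rewrite in_setU in_setU in_setC in_setD; case: (x \in Q); case: (x \in C).
exists b; rewrite negbK in c1; apply: cov_sub (covU c1 (cov_path mq)); first by lia.
by apply/subsetP => x _; rewrite in_setU in_setC -/Q; case: (x \in Q).
Qed.

Variable D : nat.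
Hypotheses (D40 : 40 * D <= #|V|)
  (deg_D : {in ~: Q, forall x, #|[set y in Q | hue b x y]| <= D}).

Lemma cov_many_outside : 11 * k <= 10 * #|~: Q| -> exists b', cov b' k setT.
Proof.
move=> many.
(* The size is [1.1 k] rounded up, so chains through [S] number about [10 k / 11] at most. *)
have [||S [_ sS cardS]] := @subset_between V set0 (~: Q) ((11 * k + 9) %/ 10).
- exact: sub0set.
- by rewrite cards0; move: many; move: (#|~: Q|) => w; lia.
have [||t|A [p [sA cA szA ltA]]] := @cov_chains (~~ b) D S Q.
- by rewrite cardS; lia.
- by rewrite disjoint_sym dQ.
- by move/(subsetP sS)/deg_D; rewrite negbK.
have arith n d a w : k * k <= n -> n <= k * k + 2 * k -> 40 * d <= n ->
    p * ((11 * k + 9) %/ 10) <= n -> a < 2 * d + (11 * k + 9) %/ 10 -> 50 * w <= n ->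
    [/\ 11 * p <= 10 * k + 20, 100 * a <= 99 * ((k - 1 - p) * (k - 1))
      & 100 * w <= 99 * ((k - 1 - p) * (k - 1))].
  move=> nlb nub d40 pn ad wn.
  have pk : 11 * p <= 10 * k + 20.
    rewrite -(@leq_pmul2r k) ?(leq_trans _ k_big) //.
    have : p * (11 * k) <= p * (10 * ((11 * k + 9) %/ 10)) by rewrite leq_mul2l; apply/orP; right; lia.
    by lia.
  have [l kl] : exists l, k = l.+1 by exists k.-1; rewrite prednK // (leq_trans _ k_big).
  have -> : k - 1 = l by rewrite kl subn1.
  move: k_big nlb nub ad pk; rewrite kl; clear -d40 wn => lbig nlb nub ad pk.
  have lr : l * l <= (11 * (l - p) + 30) * l by rewrite leq_mul2r; apply/orP; right; lia.
  have big2 : 100 * 100 * l <= l * l by rewrite leq_mul2r; apply/orP; right; lia.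
  by move: (l - p) lr => r lr; split=> //; lia.
have szS : p * #|S| <= #|V| by apply: leq_trans (leq_addr _ _) (leq_trans szA (max_card _)).
rewrite cardS in szS ltA.
have [pk szU szW] := arith _ _ _ _ n_lb n_ub D40 szS ltA few_out.
have dAQ : [disjoint A & ~: Q] by apply: dQ.
have [||||cU|cW] := cover_bipartite (~~ b) hM hk _ _ _ _ dAQ szU szW; try lia.
  exists (~~ b); apply: cov_sub (covU cA (covU cU cQ')); first by lia.
  by apply/subsetP => x _; rewrite !in_setU in_setC in_setD; case: (x \in Q); case: (x \in A).
exists b; rewrite negbK in cW; apply: cov_sub (covU cW (cov_path mq)); first by lia.
by apply/subsetP => x _; rewrite in_setU in_setC -/Q; case: (x \in Q).
Qed.

Lemma cov_few_outside : 10 * #|~: Q| < 11 * k -> exists b', cov b' k setT.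
Proof.
move=> few; have [small|big] := ltnP #|~: Q| k.
  exists b; apply: cov_sub (covU (cov_path mq) (cov_singles b (~: Q))); first exact: small.
  by apply/subsetP => x _; rewrite in_setU in_setC -/Q; case: (x \in Q).
have [j sj] : exists j, #|~: Q| = k + j by exists (#|~: Q| - k); rewrite subnKC.
have j10 : 10 * j < k by move: few; rewrite sj; clear; lia.
(* Covering [2 * j.+1] outside vertices in pairs lowers the count from [1 + (k + j)] to [k]. *)
have save (A : {set V}) : A \subset ~: Q -> 2 * j.+1 <= #|A| ->
    {in A &, forall x y, x != y -> cov b 1 [set x; y]} -> exists b', cov b' k setT.
  move=> sA szA pA; have [|A' [_ sA' cardA']] := @subset_between V set0 A (2 * j.+1) (sub0set _).
    by rewrite cards0.
  exists b; apply: (cov_save_pairs (A := A') (i := j.+1) mq) => //.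
  - by move=> x y /(subsetP sA') xA /(subsetP sA') yA; apply: pA.
  - exact: subset_trans sA' sA.
  - by rewrite -/Q sj addnS.
have [[T [f [sT cardT injf fQ bf]]]|[T [B [sT sB cardT cardB cTB]]]] :=
  matching_or_separation b (~: Q) Q (2 * j.+1).
  apply: (save T) => //; first by rewrite cardT.
  move=> x y xT yT xy; apply: (@cov_path_segment b q x (f x) y (f y)) => //.
  - by have := fQ x xT; rewrite inE.
  - by have := fQ y yT; rewrite inE.
  - by apply: contraNneq xy => /injf->.
  - by have := subsetP sT x xT; rewrite !inE.
  - by have := subsetP sT y yT; rewrite !inE.
  - exact: bf.
  - exact: bf.
pose N y := [set x in ~: Q | hue b x y].
(* If [y] has that many neighbours of hue [b] outside, any two of them are joined through [y].
   Otherwise even a vertex of [B] has a neighbour of the other hue in [X], and so can end a threaded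
   path. *)
have [/existsP[y /andP[yQ szN]]|/existsPn Ny] := boolP [exists y, (y \in Q) && (2 * j.+1 <= #|N y|)].
  apply: (save (N y)) => //; first by apply/subsetP => x; rewrite inE => /andP[].
  move=> u v; rewrite !inE => /andP[uq uy] /andP[vq vy] uv.
  have mp : mpath b [:: u; y; v].
    rewrite /mpath /= !inE negb_or uv uy hue_sym vy !andbT.
    have yq : y \in q by move: yQ; rewrite inE.
    by apply/andP; split; [apply: contraNneq uq => -> | apply: contraNneq vq => <-].
  apply: cov_sub (cov_path mp) => //; apply/subsetP => z; rewrite !inE.
  by case/orP=> ->; rewrite ?orbT.
have {Ny} szN y : y \in Q -> #|N y| <= (2 * j).+1.
  by move=> yQ; have := Ny y; rewrite yQ andTb -ltnNge mulnS.
(* [B] is enlarged to [k] vertices, one end [e] for each of the [k] paths. *)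
have [|E [sBE sEQ cardE']] := @subset_between V B Q k sB.
  apply/andP; split; first by apply: leq_trans (ltnW cardB) _; move: j10 k_big; clear; lia.
  move: (#|Q|) (#|V|) cardQ n_lb k_big; rewrite sj => u n un nlb kb.
  have : 100 * k <= k * k by rewrite leq_mul2r; apply/orP; right; lia.
  by move: j10 un nlb; clear; lia.
pose R := Q :\: E; pose X := ~: Q :\: T.
have cardR : #|R| = #|Q| - k by rewrite cardsD (setIidPr sEQ) cardE'.
have cardX : #|T| + #|X| = k + j by rewrite cardsD (setIidPr sT) sj subnKC // -sj subset_leq_card.
have TX : T :|: X = ~: Q.
  apply/setP => x; rewrite in_setU in_setD.
  by have [/(subsetP sT) ->|] := boolP (x \in T).
have dTX : [disjoint T & X].
  by apply: disjointI => x xT; rewrite inE xT.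
have dR : [disjoint R & T :|: X] by rewrite TX dQ ?subsetDl.
have cXR : {in X & R, forall x y, hue (~~ b) x y}.
  move=> x y xX yR; apply: cTB => //; move: yR; rewrite !inE => /andP[yE ->].
  by rewrite andbT; apply: contra yE => /(subsetP sBE).
have fewT : {in T, forall t, #|[set y in R | hue (~~ ~~ b) t y]| <= D}.
  move=> t /(subsetP sT)/deg_D; apply: leq_trans; apply/subset_leq_card/subsetP => y.
  by rewrite negbK !inE => /andP[/andP[_ ->]].
have T_le : #|T| <= (2 * j).+1 by move: cardT; rewrite mulnS.
(* The last inequality amounts to [#|Q| <= k * (k + j + 1)]; for [j = 0] and [#|V| = k * k + 2 * k]
   it is an equality. *)
have [X_big R_big TX_R R_X] : [/\ (2 * j).+1 < #|X|, 2 * D + k * #|T|.+1 <= #|R|,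
    #|T| + #|X| <= #|R| & #|R| - k * #|T|.+1 <= k * #|X|.-1].
  rewrite cardR; move: (#|Q|) (#|T|) (#|X|) (#|V|) cardQ n_lb n_ub k_big cardX T_le D40.
  rewrite sj; move: j10; clear => j10 u t x n un nlb nub kb tx tj d40.
  have big : 100 * 100 * k <= k * k by rewrite leq_mul2r; apply/orP; right; lia.
  have kj : k * (10 * j) <= k * k by rewrite leq_mul2l; apply/orP; right; lia.
  have kt : k * t.+1 <= k * (2 * j).+2 by rewrite leq_mul2l; apply/orP; right; lia.
  have ktx : k * t + k * x = k * k + k * j by rewrite -!mulnDr tx.
  have x0 : 0 < x by lia.
  have -> : k * x.-1 = k * x - k by rewrite -subn1 mulnBr muln1.
  by rewrite mulnS in kt *; split; lia.
have sizeE : size (enum E) = k by rewrite -cardE cardE'.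
have [|||||C [sC cardC covC]] := @cov_threaded_family (~~ b) D T X R dTX dR cXR fewT (enum E) R.
- exact: leq_ltn_trans X_big.
- move=> e; rewrite mem_enum => eE; have eQ := subsetP sEQ e eE; split.
  + by rewrite inE eE.
  + by rewrite TX inE eQ.
  + have [|x xX xN] := @ex_outside _ X (N e); first exact: leq_ltn_trans (szN _ eQ) X_big.
    exists x => //; rewrite -hueN; apply: contra xN => xe.
    by case/setDP: xX => xX _; rewrite inE xX.
- by [].
- by rewrite sizeE.
- exact: TX_R.
rewrite sizeE in cardC covC.
exists (~~ b); apply: (cov_sub (leqnn k) _ (covC (R :\: C) (subxx _) _)); last first.
  by rewrite cardsD (setIidPr sC) cardC.
have -> : (if enum E is [::] then set0 else T :|: X) = ~: Q.
  rewrite TX; case: (enum E) sizeE => // k0; suff : false by [].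
  by move: k_big; rewrite -k0.
apply/subsetP => x _; rewrite !inE mem_enum.
by case: (x \in E); case: (x \in q); case: (x \in C).
Qed.

End OneLongPath.

(** * Assembling the cases *)

Lemma cov_of_long_path M k b q0 :
  100 * 100 * 100 * 100 * 10 <= M -> 100 * 100 * 10 * M <= k ->
  k * k <= #|V| -> #|V| <= k * k + 2 * k ->
  mpath b q0 -> cov (~~ b) 1 (~: [set x in q0]) -> 50 * #|~: [set x in q0]| <= #|V| ->
  exists b', cov b' k setT.
Proof.
move=> hM hk nlb nub mq0 cq0 few0; have [q [mq sq0 maxq]] := longest_mpath mq0.
have sub : ~: [set x in q] \subset ~: [set x in q0].
  by rewrite setCS; apply/subsetP => x; rewrite !inE => /sq0.
have cQ := cov_sub (leqnn 1) sub cq0.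
have few : 50 * #|~: [set x in q]| <= #|V|.
  by apply: leq_trans few0; rewrite leq_mul2l subset_leq_card.
have [/existsP[x /andP[xq degx]]|/existsPn deg] :=
  boolP [exists x, (x \notin q) && (#|V| < 40 * #|[set y in [set y in q] | hue b x y]|)].
  have [C [sC cC szC]] := successor_clique mq maxq xq.
  apply: (cov_by_clique hM hk nlb nub mq cQ few sC cC).
  apply: leq_trans (ltnW degx) _; rewrite leq_mul2l /=.
  apply: leq_trans szC.
  by apply/subset_leq_card/subsetP => y; rewrite !inE.
pose D := #|V| %/ 40.
have D40 : 40 * D <= #|V| by rewrite mulnC leq_divM.
have degD : {in ~: [set x in q], forall x, #|[set y in [set x in q] | hue b x y]| <= D}.
  move=> x; rewrite !inE => xq; have := deg x; rewrite xq /= -leqNgt => le.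
  by rewrite leq_divRL // mulnC.
have [many|few'] := leqP (11 * k) (10 * #|~: [set x in q]|).
  exact: (cov_many_outside hM hk nlb nub mq cQ few D40 degD many).
exact: (cov_few_outside hM hk nlb nub mq few D40 degD few').
Qed.

Lemma monochromatic_cov M k :
  100 * 100 * 100 * 100 * 10 <= M -> 100 * 100 * 10 * M <= k ->
  k * k <= #|V| -> #|V| <= k * k + 2 * k -> exists b, cov b k setT.
Proof.
move=> hM hk nlb nub; have [p [q [mp mq pq]]] := two_path_partition.
set Y := [set x in q].
have sYp : ~: Y \subset [set x in p].
  by apply/subsetP => x; rewrite !inE => xq; have := pq x; rewrite (negPf xq) orbF.
have spY : ~: [set x in p] \subset Y by rewrite -setCS setCK.
have cY := cov_sub (leqnn 1) sYp (cov_path mp).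
have cp := cov_sub (leqnn 1) spY (cov_path mq).
have long u w : u + w = #|V| -> 99 * ((k - 1) * (k - 1)) < 100 * u -> 50 * w <= #|V|.
  move: hM hk nlb nub; case: k => [|l]; first by lia.
  have -> : l.+1 - 1 = l by rewrite subn1.
  move: (#|V|) => n hM hk nlb nub uw ul.
  have big : 100 * 100 * l <= l * l by rewrite leq_mul2r; apply/orP; right; lia.
  by lia.
(* The threshold is what [cover_bipartite] allows with [k - 1] paths in each colour; the remaining
   path is [p] or [q]. *)
have [bigY|smallY] := ltnP (99 * ((k - 1) * (k - 1))) (100 * #|Y|).
  by apply: (cov_of_long_path hM hk nlb nub mq cY); apply: long bigY; apply: cardsC.
have [bigX|smallX] := ltnP (99 * ((k - 1) * (k - 1))) (100 * #|~: Y|).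
  apply: (cov_of_long_path hM hk nlb nub mp cp).
  apply: (long #|[set x in p]|); first exact: cardsC.
  by apply: leq_trans bigX _; rewrite leq_mul2l subset_leq_card.
have dY : [disjoint Y & ~: Y] by rewrite -setI_eq0 setICr.
have k0 : k = (k - 1) + 1 by lia.
have [||||c1|c1] := cover_bipartite true hM hk _ _ _ _ dY smallY smallX; try lia.
  by exists true; rewrite k0 -(setUCr Y); apply: covU.
by exists false; rewrite k0 -(setUCr Y) setUC; apply: covU => //; apply: cov_path.
Qed.

End TwoColouring.

(* "at most sqrt n paths": for a natural number k, k <= sqrt n iff k^2 <= n. *)
Theorem theorem1p3 :
  exists n0 : nat, forall n : nat, n0 < n ->
    forall c : 'I_n -> 'I_n -> bool, edge_colouring c ->
      exists (b : bool) (P : seq (seq 'I_n)),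
        (size P) ^ 2 <= n /\
        (forall p, p \in P -> mono_colour_path c b p) /\
        covers P.
Proof.
have [M hM] : exists M, 100 * 100 * 100 * 100 * 10 <= M by eexists; apply: leqnn.
pose K := 100 * 100 * 10 * M; exists (K * K) => n ltn c c_sym.
have [k [kn nk]] : exists k, k * k <= n /\ n < k.+1 * k.+1.
  have exk : exists k, k * k <= n by exists 0.
  have lek k : k * k <= n -> k <= n.
    by apply: leq_trans; case: k => // k; rewrite leq_pmull.
  case: (ex_maxnP exk lek) => k kn maxk; exists k; split=> //.
  by rewrite ltnNge; apply/negP => /maxk; rewrite ltnn.
have Kk : K <= k.
  rewrite -ltnS ltnNge; apply/negP => kK; have := leq_mul kK kK.
  by rewrite leqNgt (ltn_trans ltn nk).
(* The values of c on the diagonal are arbitrary. *)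
pose d u v := (u != v) && c u v.
have d_sym : symmetric d.
  by move=> u v; rewrite /d eq_sym; case: eqVneq => //= vu; rewrite c_sym // eq_sym.
have [||b [P [szP mP cP]]] := @monochromatic_cov _ d d_sym M k hM Kk; rewrite ?card_ord //.
  by lia.
have mono p : mpath d b p -> p != [::] -> mono_colour_path c b p.
  case: p => // x p /andP[u s] _; split=> //.
  elim: p x u s => //= y p IHp x /and3P[]; rewrite inE negb_or => /andP[xy _] yp up.
  by rewrite /hue /d xy => /andP[-> s]; apply: IHp; rewrite ?yp.
(* [mpath] admits the empty sequence and [mono_colour_path] does not. *)
exists b, [seq p <- P | p != [::]]; split; last split.
- have szF : size [seq p <- P | p != [::]] <= k.
    by apply: leq_trans szP; rewrite size_filter count_size.
  by apply: leq_trans kn; rewrite -mulnn leq_mul.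
- by move=> p; rewrite mem_filter => /andP[p0 /mP mp]; apply: mono.
- move=> v; have [//|p pP vp] := cP v.
  by exists p; rewrite // mem_filter pP andbT; case: p vp {pP}.
Qed.
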